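(* Let $X_1,\dotsc,X_k$ be sets. Let $c\colon X_1\times\dotsb\times X_k\to\mathbb{R}$ be a bounded function. Suppose that $f_i\colon X_i\to\mathbb{R}$, $i=1,\dotsc, k$, are such that for all $x_i\in X_i$ and $i=1,\dotsc,k$ $$f_i(x_i)=\inf\Big\{c(x_1,\dotsc,x_k)-\sum_{j\neq i}f_j(x_j) \mid x_j\in X_j,\ j\neq i\Big\}.$$ Then there exist constants $h_1,\dotsc,h_k\in\mathbb{R}$ that sum up to zero, such that the functions $\tilde{f}_i=f_i+h_i$ satisfy $$\tilde{f}_i(x_i)=\inf\Big\{c(x_1,\dotsc,x_k)-\sum_{j\neq i}\tilde{f}_j(x_j) \mid x_j\in X_j,\ j\neq i\Big\}$$ for all $x_i\in X_i$ and $i=1,\dotsc,k$, and all of them are bounded by the uniform norm of $c$ times $\max\{k, 3\}$.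
   Context: The uniform norm of $c$ is $\sup|c|$ over $X_1\times\dotsb\times X_k$. *)

(* Defs.v *)
From mathcomp Require Import all_boot all_order all_algebra.
From mathcomp Require Import all_classical all_reals all_analysis.
Import Order.TTheory GRing.Theory Num.Theory.
Import numFieldNormedType.Exports.

Set Implicit Arguments.
Unset Strict Implicit.
Unset Printing Implicit Defensive.

Local Open Scope classical_set_scope.
Local Open Scope ring_scope.

(* The infimum is taken in the extended reals: the real-valued [inf] is 0 on
   sets that are empty or unbounded below. *)
Definition conjugate_tuple (R : realType) (k : nat) (X : 'I_k -> Type)
    (c : (forall i, X i) -> R) (f : forall i, X i -> R) : Prop :=
  forall (i : 'I_k) (xi : X i),
    ((f i xi)%:E = ereal_inf
       [set (c x - \sum_(j < k | j != i) f j (x j))%:E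
         | x in [set x : forall j, X j | x i = xi]])%E.

(* The real-valued [sup] is the actual supremum only for a bounded [g] on a
   nonempty domain; it is 0 on an empty domain. *)
Definition uniform_norm (R : realType) (T : Type) (g : T -> R) : R :=
  sup (range (fun t => `|g t|)).

(* Main.v *)
(** Put s_i := sup f_i, S := s_1 + ... + s_k and M := the uniform norm of c.
    Choosing almost maximal points independently in each coordinate gives
    S <= M, while inserting s_j for f_j and -M for c in the infimum gives
    f_i >= s_i - S - M, whence also S >= -M. The shift h_i := S/k - s_i makes
    all suprema equal to S/k and puts f_i + h_i in [S/k - S - M, S/k], so even
    the bound 2M holds. *)

Require Import Defs.
From mathcomp Require Import all_boot all_order all_algebra.
From mathcomp Require Import all_classical all_reals all_analysis.
From mathcomp Require Import lra.
Import Order.TTheory GRing.Theory Num.Theory.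
Import numFieldNormedType.Exports.

Local Open Scope classical_set_scope.
Local Open Scope ring_scope.

Lemma le_uniform_norm (R : realType) (T : Type) (g : T -> R) (t : T) :
  bounded_fun g -> `|g t| <= uniform_norm g.
Proof.
move=> [B [_ gB]]; apply: ub_le_sup; last by exists t.
(* [bounded_fun] provides bounds only strictly beyond [B], hence [B + 1]. *)
exists (B + 1) => _ [u _ <-].
by apply: (gB (B + 1)) => //; rewrite ltrDl.
Qed.

Lemma ereal_inf_shift (R : realType) (T : Type) (A : set T) (g : T -> R)
    (h : R) :
  ereal_inf [set (g t + h)%:E | t in A] =
  (ereal_inf [set (g t)%:E | t in A] + h%:E)%E.
Proof.
apply/eqP; rewrite eq_le; apply/andP; split.
  rewrite -leeBlDr //; apply/ereal_infP => _ [t At <-].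
  rewrite leeBlDr // -EFinD; apply: ge_ereal_inf.
  by exists (g t + h)%:E => //; exists t.
apply/ereal_infP => _ [t At <-]; rewrite EFinD leeD2r //.
by apply: ge_ereal_inf; exists (g t)%:E => //; exists t.
Qed.

Section ConjugateTuple.
Set Implicit Arguments.
Unset Strict Implicit.
Context {R : realType} {k : nat} {X : 'I_k -> Type}.
Implicit Types (c : (forall i, X i) -> R) (f : forall i, X i -> R).

Lemma conjugate_tuple_shift c f (h : 'I_k -> R) :
  \sum_(i < k) h i = 0 -> conjugate_tuple c f ->
  conjugate_tuple c (fun i xi => f i xi + h i).
Proof.
move=> h0 fc i xi; rewrite EFinD fc -ereal_inf_shift.
congr ereal_inf; apply: eq_imagel => x _; congr (_%:E).
(* Because the shifts sum to zero, subtracting those with index [j != i] amounts to adding [h i], so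
   every element of the set moves by [h i]. *)
have := h0; rewrite (bigD1 i) //= => /eqP; rewrite addr_eq0 => /eqP ->.
by rewrite big_split /=; lra.
Qed.

Lemma conjugate_tuple_le c f (x : forall i, X i) (i : 'I_k) :
  conjugate_tuple c f -> f i (x i) + \sum_(j < k | j != i) f j (x j) <= c x.
Proof.
move=> fc; rewrite -lerBrDr -lee_fin fc.
by apply: ge_ereal_inf; eexists; first by exists x.
Qed.

Lemma conjugate_tuple_ge c f (i : 'I_k) (xi : X i) (m : R) :
  conjugate_tuple c f ->
  (forall x, m <= c x - \sum_(j < k | j != i) f j (x j)) -> m <= f i xi.
Proof.
move=> fc mP; rewrite -lee_fin fc; apply/ereal_infP => _ [x _ <-].
by rewrite lee_fin.
Qed.

(* An infimum over the empty set would be +oo, but [f i xi] is finite. *)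
Lemma conjugate_tuple_point c f (i : 'I_k) (xi : X i) :
  conjugate_tuple c f -> inhabited (forall j, X j).
Proof.
move=> /(_ i xi) fc.
have [[x _]|/forallNP nox] := pselect (exists x : forall j, X j, x i = xi).
  exact: inhabits.
move: fc; rewrite (_ : [set x | _] = set0) ?image_set0 ?ereal_inf0 //.
by rewrite -subset0 => x /nox.
Qed.

(** Freezing all coordinates except the [i]-th at [x0] turns the inequality with [c] into an upper
    bound for [f i] that does not depend on [xi]. *)
Lemma conjugate_tuple_has_sup c f (x0 : forall i, X i) (i : 'I_k) :
  bounded_fun c -> conjugate_tuple c f -> has_sup (range (f i)).
Proof.
move=> cB fc; split; first by exists (f i (x0 i)), (x0 i).
exists (uniform_norm c - \sum_(j < k | j != i) f j (x0 j)) => _ [xi _ <-].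
have := conjugate_tuple_le (@dfwith _ _ x0 i xi) i fc.
rewrite dfwithin (eq_bigr (fun j => f j (x0 j))); last first.
  by move=> j ji; rewrite dfwithout // eq_sym.
have := le_trans (ler_norm _) (le_uniform_norm _ _ _ (@dfwith _ _ x0 i xi) cB).
lra.
Qed.

Lemma sum_sup_le (f : forall i, X i -> R) (M : R) :
  (forall i, has_sup (range (f i))) ->
  (forall x : forall i, X i, \sum_(i < k) f i (x i) <= M) ->
  \sum_(i < k) sup (range (f i)) <= M.
Proof.
move=> fS fM; apply/ler_addgt0Pr => e e0.
(* Dividing by [k.+1] instead of [k] keeps the tolerance positive when [k = 0]; the total loss
   [k * e / k.+1] is still at most [e]. *)
have d0 : 0 < e / k.+1%:R by rewrite divr_gt0.
have near_sup i : {y : X i | sup (range (f i)) - e / k.+1%:R < f i y}.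
  apply: cid; have [_ [y _ <-] ?] := sup_adherent d0 (fS i).
  by exists y.
have := fM (fun i => sval (near_sup i)).
rewrite -(lerD2r e); apply: le_trans; rewrite -lerBlDr.
apply: (@le_trans _ _ (\sum_(i < k) (sup (range (f i)) - e / k.+1%:R))).
  rewrite sumrB lerB // sumr_const card_ord -[_ *+ k]mulr_natr -mulrA.
  rewrite ler_piMr ?(ltW e0) // mulrC ler_pdivrMr // mul1r ler_nat.
  exact: leqnSn.
by apply: ler_sum => i _; apply: ltW; exact: svalP (near_sup i).
Qed.

End ConjugateTuple.

Theorem lemma10p3 (R : realType) (k : nat) (X : 'I_k -> Type)
    (c : (forall i, X i) -> R) (c_bounded : bounded_fun c)
    (f : forall i, X i -> R) (f_conj : conjugate_tuple c f) :
  exists h : 'I_k -> R,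
    [/\ \sum_(i < k) h i = 0,
        conjugate_tuple c (fun i xi => f i xi + h i) &
        forall (i : 'I_k) (xi : X i),
          `|f i xi + h i| <= (maxn k 3)%:R * uniform_norm c].
Proof.
pose s i := sup (range (f i)); pose S := \sum_(i < k) s i.
pose h i := S / k%:R - s i.
have h0 : \sum_(i < k) h i = 0.
  rewrite /h sumrB sumr_const card_ord -[_ *+ k]mulr_natr -/S.
  (* For [k = 0] the quotient [S / k%:R] is a default value, but it is multiplied by 0 and [S] is an
     empty sum. *)
  have [k0|k0] := posnP k; last by rewrite divfK ?subrr ?pnatr_eq0 ?lt0n_neq0.
  rewrite k0 mulr0 /S big1 ?subrr // => -[m mk] _; exfalso.
  by rewrite k0 in mk.
exists h; split=> //; first exact: conjugate_tuple_shift.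
move=> i xi; have [x0] := conjugate_tuple_point xi f_conj.
set M := uniform_norm c.
have cM x : `|c x| <= M by apply: le_uniform_norm.
have fS j : has_sup (range (f j)) by apply: conjugate_tuple_has_sup f_conj.
have fs j (y : X j) : f j y <= s j.
  by apply: sup_upper_bound => //; exists y.
have SM : S <= M.
  apply: sum_sup_le => // x; rewrite (bigD1 i) //=.
  apply: le_trans (conjugate_tuple_le x i f_conj) _.
  exact: le_trans (ler_norm _) (cM x).
have S_split : S = s i + \sum_(j < k | j != i) s j by rewrite /S (bigD1 i).
have f_ge : s i - S - M <= f i xi.
  apply: conjugate_tuple_ge f_conj _ => x.
  have : \sum_(j < k | j != i) f j (x j) <= \sum_(j < k | j != i) s j.
    by apply: ler_sum => j _; exact: fs.
  by have := cM x; rewrite ler_norml => /andP[]; lra.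
have f_le := fs i xi.
have M0 : 0 <= M := le_trans (normr_ge0 _) (cM x0).
have k1 : 1 <= k%:R :> R by rewrite ler1n (leq_ltn_trans _ (ltn_ord i)).
have k0 : 0 < k%:R :> R by exact: lt_le_trans k1.
have Sk_le : S / k%:R <= M.
  by rewrite ler_pdivrMr // (le_trans SM) // ler_peMr.
(* This rests on the identity S/k - S + M = (M - S)(1 - 1/k) + M/k, whose two terms are nonnegative
   since S <= M, k >= 1 and M >= 0. *)
have SkS_ge : - M <= S / k%:R - S.
  have u1 : k%:R^-1 <= 1 :> R by rewrite invf_le1.
  have u0 : 0 <= k%:R^-1 :> R by rewrite invr_ge0 ltW.
  have : 0 <= (M - S) * (1 - k%:R^-1) by rewrite mulr_ge0 // subr_ge0.
  have : 0 <= M * k%:R^-1 by rewrite mulr_ge0.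
  by rewrite mulrBr mulr1 mulrBl; lra.
have three : 3 * M <= (maxn k 3)%:R * M.
  by rewrite ler_wpM2r // ler_nat leq_maxr.
(* The shifted value lies between S/k - S - M >= -2M and S/k <= M, hence within 3M. *)
by apply: le_trans three; rewrite ler_norml /h; apply/andP; split; lra.
Qed.
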